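(* Let $M,A,P,L,T$ be positive constants. Let $u:\mathbb{R}\times[0,T)\to\mathbb{R}$ be an $H_2$ solution of $$u_t=a(u_x,u,x,t)u_{xx}+b(u_x),\qquad u(\cdot,0)=u_0,$$ where $a>0$; $u_0$ is continuous; both $u_0$ and $a$ are periodic, $u_0(x+L)=u_0(x)$ and $a(p,q,x,t)=a(p,q,x+L,t)$ (and $u$ is therefore also periodic, $u(x+L,t)=u(x,t)$); $\operatorname{osc}u(\cdot,t)\le M$ for all $t$; and $$a(p,q,x,t)\,p^2\ge A\quad\text{for all }|p|\ge P\text{ and all }q,x,t.$$ Then there are $T'>0$, $C_1$ and $C_2$, depending only on $M$, $A$ and $P$, such that for all $t\in(0,T']$ (with $t<T$) and all $x\in\mathbb{R}$, $$|u_x(x,t)|\le C_1\sqrt{t}\,(1+t)\exp(C_2/t).$$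
   Context: $\operatorname{osc} f=\sup f-\inf f$. Solutions are understood in the classical sense. For an integer $k\ge0$ and $\alpha\in(0,1]$, $H_{k+\alpha}(Q)$ is the parabolic Hölder space of functions with finite norm $\sum_{|\beta|+2j\le k}\sup|D^\beta_xD^j_tu|+\sum_{|\beta|+2j=k}[D_x^\beta D_t^ju]_{\alpha,\alpha/2}$, where $[w]_{\alpha,\alpha/2}=\sup_{(x_1,t_1)\neq(x_2,t_2)}|w(x_1,t_1)-w(x_2,t_2)|/(|x_1-x_2|+|t_1-t_2|^{1/2})^\alpha$; $H_2$ is the case $k+\alpha=2$.
   Formalization: The periodicity u(x+L,t)=u(x,t), which the text says follows from that of u_0 and a, is assumed as a hypothesis; with no regularity required of a it need not follow. *)

(* Defs.v *)
From Stdlib Require Import Reals.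
From Coquelicot Require Import Coquelicot.

Open Scope R_scope.

Definition osc (f : R -> R) : Rbar :=
  Rbar_minus (Lub_Rbar (fun r => exists x, r = f x))
             (Glb_Rbar (fun r => exists x, r = f x)).

(* Functions of space-time are written [u x t], space first. *)

Definition d_x (u : R -> R -> R) (x t : R) : R := Derive (fun y => u y t) x.
Definition d_xx (u : R -> R -> R) (x t : R) : R := Derive_n (fun y => u y t) 2 x.
Definition d_t (u : R -> R -> R) (x t : R) : R := Derive (fun s => u x s) t.

(* The domain R x [0, T); values of [u] outside it are never constrained. *)
Definition slab (T : R) (x t : R) : Prop := 0 <= t < T.

Definition sup_norm (Q : R -> R -> Prop) (w : R -> R -> R) : Rbar :=
  Lub_Rbar (fun r => exists x t, Q x t /\ r = Rabs (w x t)).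

(* [w]_{alpha, alpha/2} on Q *)
Definition holder_seminorm (alpha : R) (Q : R -> R -> Prop)
    (w : R -> R -> R) : Rbar :=
  Lub_Rbar (fun r => exists x1 t1 x2 t2,
    Q x1 t1 /\ Q x2 t2 /\ (x1, t1) <> (x2, t2) /\
    r = Rabs (w x1 t1 - w x2 t2)
        / Rpower (Rabs (x1 - x2) + sqrt (Rabs (t1 - t2))) alpha).

(* As alpha ranges over (0, 1], k + alpha = 2 forces k = 1 and alpha = 1, so
   the multi-indices with |beta| + 2j <= k are those of [u] and [d_x u], and only
   [d_x u] has |beta| + 2j = k. *)
Definition H2_norm (Q : R -> R -> Prop) (u : R -> R -> R) : Rbar :=
  Rbar_plus (Rbar_plus (sup_norm Q u) (sup_norm Q (d_x u)))
            (holder_seminorm 1 Q (d_x u)).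

(* [Derive] is total, so differentiability is required separately. *)
Definition in_H2 (Q : R -> R -> Prop) (u : R -> R -> R) : Prop :=
  (forall x t, Q x t -> ex_derive (fun y => u y t) x) /\
  is_finite (H2_norm Q u).

Record classical_solution (a : R -> R -> R -> R -> R) (b : R -> R) (T : R)
    (u0 : R -> R) (u : R -> R -> R) : Prop := {
  cs_continuous : forall x t, slab T x t ->
    filterlim (fun z : R * R => u (fst z) (snd z))
      (within (fun z : R * R => slab T (fst z) (snd z)) (locally (x, t)))
      (locally (u x t));
  cs_ex_d_t : forall x t, 0 < t < T -> ex_derive (fun s => u x s) t;
  cs_ex_d_x : forall x t, 0 < t < T -> ex_derive (fun y => u y t) x;
  cs_ex_d_xx : forall x t, 0 < t < T -> ex_derive_n (fun y => u y t) 2 x;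
  cs_continuous_d_t : forall x t, 0 < t < T ->
    continuous (fun z : R * R => d_t u (fst z) (snd z)) (x, t);
  cs_continuous_d_x : forall x t, 0 < t < T ->
    continuous (fun z : R * R => d_x u (fst z) (snd z)) (x, t);
  cs_continuous_d_xx : forall x t, 0 < t < T ->
    continuous (fun z : R * R => d_xx u (fst z) (snd z)) (x, t);
  cs_equation : forall x t, 0 < t < T ->
    d_t u x t = a (d_x u x t) (u x t) x t * d_xx u x t + b (d_x u x t);
  cs_initial : forall x, u x 0 = u0 x
}.

(* Main.v *)
Require Import Defs.
From Stdlib Require Import Reals Lra Psatz List Classical ClassicalEpsilon.
From Coquelicot Require Import Coquelicot.

Open Scope R_scope.

(** Let [xi(q, t) = exp ((k q - C) / t) - exp ((- k q - C) / t)] with [k = M / A]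
    and [C = 2 M^2 / A = 2 A k^2], so that [xi_t < 2 A xi_qq] for [q > 0].  Consider
    the minimum over [y <= x] and [0 < t <= T'] of
    [(x - y) - xi (u(x,t) - u(y,t), t)].  At a negative interior minimum
    [u_x(x) = u_x(y) = 1 / xi_q >= P], so the [b] terms cancel, both diffusion
    coefficients are at least [A xi_q^2], and the first and second order conditions
    give [xi_t >= 2 A xi_qq], a contradiction.  Since [u] is Lipschitz in [x]
    uniformly in [t], while [xi_q] tends to 0 uniformly on [[0, M]] as [t] does, the
    minimum is not negative near [t = 0] either.  Letting [x] tend to [y], the bound
    [xi (u(x,t) - u(y,t), t) <= x - y] becomes
    [u_x <= 1 / xi_q(0, t) = t / (2 k) * exp (C / t)].  The same applies to [-u]. *)

(** * An exponential inequality and minima over compact boxes *)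

(** Squaring [1 + y / 2 <= exp (y / 2)] gives this. It supplies the decay of [exp (- y)] that makes
    the barrier flat for small times. *)
Lemma exp_ge_sqr (y : R) : 0 <= y -> y ^ 2 / 4 <= exp y.
Proof.
intros Hy.
assert (H : 1 + y / 2 <= exp (y / 2)).
{ destruct (Req_dec y 0) as [->|Hn].
  - replace (0 / 2) with 0 by field. rewrite exp_0; lra.
  - left; apply exp_ineq1; lra. }
replace y with (y / 2 + y / 2) at 2 by field.
rewrite exp_plus.
nra.
Qed.

Lemma list_argmin (X : Type) (f : X -> R) (l : list X) :
  l <> nil -> exists m, In m l /\ forall x, In x l -> f m <= f x.
Proof.
induction l as [|c l IH]; [easy|intros _].
destruct l as [|c' l].
- exists c; split; [now left|].
  intros x [<-|[]]; lra.
- destruct IH as [m [Hm Hmin]]; [easy|].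
  destruct (Rle_dec (f c) (f m)) as [Hc|Hc].
  + exists c; split; [now left|].
    intros x [<-|Hx]; [lra|].
    specialize (Hmin x Hx); lra.
  + exists m; split; [now right|].
    intros x [<-|Hx]; [lra|auto].
Qed.

Definition box (a1 b1 a2 b2 a3 b3 : R) (z : R * R * R) : Prop :=
  a1 <= fst (fst z) <= b1 /\ a2 <= snd (fst z) <= b2 /\ a3 <= snd z <= b3.

(** Without a minimum, every point of the box is beaten by another point, and by continuity that
    point beats a whole neighbourhood. Finitely many such neighbourhoods cover the box, so the
    lowest of the finitely many competitors would itself be beaten by one of them. *)
Lemma box_argmin (F : R * R * R -> R) (a1 b1 a2 b2 a3 b3 : R) :
  a1 <= b1 -> a2 <= b2 -> a3 <= b3 ->
  (forall z, box a1 b1 a2 b2 a3 b3 z -> continuous F z) ->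
  exists m, box a1 b1 a2 b2 a3 b3 m /\
    forall z, box a1 b1 a2 b2 a3 b3 z -> F m <= F z.
Proof.
intros H1 H2 H3 HF.
set (B := box a1 b1 a2 b2 a3 b3) in *.
set (corner := (a1, a2, a3)).
assert (Hcorner : B corner) by (unfold B, box; simpl; lra).
apply NNPP; intros Hno.
assert (Hlower : forall z, B z -> exists z', B z' /\ F z' < F z).
{ intros z Hz. apply NNPP; intros Hz'. apply Hno.
  exists z; split; [exact Hz|].
  intros z' Bz'. destruct (Rle_dec (F z) (F z')) as [|Hn]; [easy|].
  exfalso; apply Hz'; exists z'; split; [exact Bz'|lra]. }
set (vec := fun z : R * R * R => (fst (fst z), (snd (fst z), (snd z, tt)))
             : Compactness.Tn 3 R).
set (tup := fun v : Compactness.Tn 3 R =>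
             (fst v, fst (snd v), fst (snd (snd v))) : R * R * R).
assert (Hchoice : forall v : Compactness.Tn 3 R,
  exists p : posreal * (R * R * R), B (snd p) /\
    (B (tup v) -> forall w, close_n 3 (fst p) w v -> F (snd p) < F (tup w))).
{ intros v. destruct (classic (B (tup v))) as [Hv|Hv].
  - destruct (Hlower _ Hv) as [z' [Bz' Hz']].
    assert (Hpos : 0 < F (tup v) - F z') by lra.
    assert (Hc := proj1 (filterlim_locally _ _) (HF _ Hv) (mkposreal _ Hpos)).
    destruct Hc as [d Hd].
    exists (d, z'); split; [exact Bz'|].
    intros _ w Hw. simpl fst in Hw; simpl snd.
    destruct v as [v1 [v2 [v3 []]]], w as [w1 [w2 [w3 []]]].
    destruct Hw as [Hw1 [Hw2 [Hw3 _]]].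
    assert (Hb := Hd (w1, w2, w3)
      (conj (conj Hw1 Hw2) Hw3)).
    apply Rabs_lt_between in Hb.
    unfold tup in *; simpl in *.
    unfold minus, plus, opp in Hb; simpl in Hb. lra.
  (* Centres outside the box never occur in the cover, so the radius is arbitrary; only the
     competitor must lie in the box. *)
  - exists (mkposreal 1 Rlt_0_1, corner); split; [exact Hcorner|easy]. }
set (ch := fun v => constructive_indefinite_description _ (Hchoice v)).
apply (compactness_list 3 (a1, (a2, (a3, tt))) (b1, (b2, (b3, tt)))
  (fun v => fst (proj1_sig (ch v)))).
intros [l Hl].
assert (Hvec : forall z, B z -> exists v, In v l /\ B (tup v) /\
  F (snd (proj1_sig (ch v))) < F z).
{ intros [[z1 z2] z3] Hz.
  destruct (Hl (z1, (z2, (z3, tt)))) as [v [Hin [Hb Hc]]].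
  { unfold B, box in Hz; simpl in *; tauto. }
  exists v; split; [exact Hin|].
  assert (Bv : B (tup v)).
  { destruct v as [v1 [v2 [v3 []]]]; unfold B, box; simpl in *; tauto. }
  split; [exact Bv|].
  exact (proj2 (proj2_sig (ch v)) Bv _ Hc). }
destruct (list_argmin _ (fun v => F (snd (proj1_sig (ch v)))) l) as [m [_ Hm]].
{ intros ->. destruct (Hvec _ Hcorner) as [v [[] _]]. }
destruct (Hvec _ (proj1 (proj2_sig (ch m)))) as [v [Hv [_ Hlt]]].
exact (Rlt_not_le _ _ Hlt (Hm v Hv)).
Qed.

(** * Derivative tests at a minimum *)

(** Difference quotients from the left are nonpositive. The one-sided form is needed in time, where
    the minimum may sit at the last instant considered. *)
Lemma is_derive_left_min (f : R -> R) (l t d : R) :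
  0 < d -> is_derive f t l -> (forall s, t - d < s <= t -> f t <= f s) -> l <= 0.
Proof.
intros Hd Hf Hmin.
destruct (Rle_dec l 0) as [|Hl]; [easy|exfalso].
apply is_derive_Reals in Hf.
destruct (Hf (l / 2) ltac:(lra)) as [r Hr].
set (h := Rmin (d / 2) (r / 2)).
assert (0 < r) by apply cond_pos.
assert (Hh : 0 < h <= d / 2 /\ h <= r / 2).
{ unfold h; split; [split|]; [apply Rmin_pos; lra|apply Rmin_l|apply Rmin_r]. }
assert (H1 := Hr (- h) ltac:(lra) ltac:(rewrite Rabs_Ropp, Rabs_pos_eq; lra)).
assert (H2 := Hmin (t + - h) ltac:(lra)).
apply Rabs_lt_between in H1.
assert (H3 : (f (t + - h) - f t) / - h <= 0).
{ replace ((f (t + - h) - f t) / - h) with (- ((f (t + - h) - f t) / h))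
    by (field; lra).
  assert (0 <= (f (t + - h) - f t) / h) by (apply Rdiv_le_0_compat; lra).
  lra. }
lra.
Qed.

Lemma is_derive_local_min (f : R -> R) (l x d : R) :
  0 < d -> is_derive f x l -> (forall y, Rabs (y - x) < d -> f x <= f y) -> l = 0.
Proof.
intros Hd Hf Hmin. apply Rle_antisym.
- apply (is_derive_left_min f l x d Hd Hf).
  intros s Hs; apply Hmin, Rabs_def1; lra.
- enough (- l <= 0) by lra.
  apply (is_derive_left_min (fun y => f (- y)) (- l) (- x) d Hd).
  + replace (- l) with (scal (-1) l) by (unfold scal; simpl; unfold mult; simpl; ring).
    apply (is_derive_comp f (fun y => - y)).
    * now rewrite Ropp_involutive.
    * auto_derive; [easy|ring].
  + intros s Hs. rewrite Ropp_involutive. apply Hmin, Rabs_def1; lra.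
Qed.

(** Since [df x = 0], a negative [l] would make [df] negative just to the right of [x], whereas the
    mean value theorem produces a point there with [df c >= 0]. *)
Lemma second_derivative_local_min (f df : R -> R) (l x d : R) :
  0 < d -> (forall y, Rabs (y - x) < d -> is_derive f y (df y)) ->
  is_derive df x l -> (forall y, Rabs (y - x) < d -> f x <= f y) -> 0 <= l.
Proof.
intros Hd Hf Hdf Hmin.
assert (H0 : df x = 0).
{ apply (is_derive_local_min f _ x d Hd); [|exact Hmin].
  apply Hf; rewrite Rminus_diag, Rabs_R0; lra. }
destruct (Rle_dec 0 l) as [|Hl]; [easy|exfalso].
apply is_derive_Reals in Hdf.
destruct (Hdf (- l / 2) ltac:(lra)) as [r Hr].
set (h := Rmin (d / 2) (r / 2)).
assert (0 < r) by apply cond_pos.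
assert (Hh : 0 < h <= d / 2 /\ h <= r / 2).
{ unfold h; split; [split|]; [apply Rmin_pos; lra|apply Rmin_l|apply Rmin_r]. }
destruct (MVT_cor2 f df x (x + h) ltac:(lra)) as [c [He Hc]].
{ intros y Hy; apply is_derive_Reals, Hf, Rabs_def1; lra. }
assert (H1 := Hmin (x + h) ltac:(apply Rabs_def1; lra)).
assert (Hdc : 0 <= df c) by nra.
assert (H2 := Hr (c - x) ltac:(lra) ltac:(rewrite Rabs_pos_eq; lra)).
replace (x + (c - x)) with c in H2 by ring.
apply Rabs_lt_between in H2.
assert (0 <= (df c - df x) / (c - x)) by (apply Rdiv_le_0_compat; lra).
lra.
Qed.

(** * The barrier, its derivatives and its size for small times *)

(* In terms of the inverse function [phi] of [xi(., t)], the equation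
   [xi_t = 2 A xi_qq] is [phi_t = 2 A phi_ss / phi_s^2]. *)
Definition barrier (M A q t : R) : R :=
  exp ((M / A * q - 2 * M ^ 2 / A) / t) - exp ((- (M / A) * q - 2 * M ^ 2 / A) / t).

Definition barrier_q (M A q t : R) : R :=
  M / A / t * (exp ((M / A * q - 2 * M ^ 2 / A) / t)
               + exp ((- (M / A) * q - 2 * M ^ 2 / A) / t)).

Definition barrier_qq (M A q t : R) : R := (M / A / t) ^ 2 * barrier M A q t.

(** The partial derivative in [t] at fixed [q]. Differentiating the constant part of the exponents
    gives exactly [2 * A * barrier_qq], because [2 * M ^ 2 / A = 2 * A * (M / A) ^ 2]. The part
    linear in [q] gives the second term, which makes the inequality strict for [q > 0]. *)
Definition barrier_t (M A q t : R) : R :=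
  2 * A * barrier_qq M A q t - q / t * barrier_q M A q t.

Lemma is_derive_barrier_q (M A q t : R) : A <> 0 -> t <> 0 ->
  is_derive (fun r => barrier M A r t) q (barrier_q M A q t).
Proof.
intros HA Ht. unfold barrier, barrier_q.
auto_derive; [easy|]. unfold Rdiv, Rsqr, Rminus. simpl. field; auto.
Qed.

Lemma is_derive_barrier_qq (M A q t : R) : A <> 0 -> t <> 0 ->
  is_derive (fun r => barrier_q M A r t) q (barrier_qq M A q t).
Proof.
intros HA Ht. unfold barrier_q, barrier_qq, barrier.
auto_derive; [easy|]. unfold Rdiv, Rsqr, Rminus. simpl. field; auto.
Qed.

Lemma is_derive_barrier_comp (M A t dq : R) (q : R -> R) : A <> 0 -> t <> 0 ->
  is_derive q t dq ->
  is_derive (fun s => barrier M A (q s) s) t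
    (barrier_t M A (q t) t + barrier_q M A (q t) t * dq).
Proof.
intros HA Ht Hq. unfold barrier, barrier_t, barrier_q, barrier_qq, barrier.
auto_derive; [repeat split; auto; now exists dq|].
replace (Derive (fun s => q s) t) with dq by (symmetry; now apply is_derive_unique).
unfold Rdiv, Rsqr, Rminus. simpl. field; auto.
Qed.

Lemma barrier_0 (M A t : R) : barrier M A 0 t = 0.
Proof. unfold barrier. rewrite !Rmult_0_r. ring. Qed.

Lemma barrier_q_pos (M A q t : R) : 0 < M -> 0 < A -> 0 < t ->
  0 < barrier_q M A q t.
Proof.
intros HM HA Ht. unfold barrier_q.
apply Rmult_lt_0_compat.
- repeat apply Rdiv_lt_0_compat; lra.
- apply Rplus_lt_0_compat; apply exp_pos.
Qed.

Lemma barrier_mvt (M A q t : R) : A <> 0 -> t <> 0 -> 0 < q ->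
  exists c, 0 < c < q /\ barrier M A q t = barrier_q M A c t * q.
Proof.
intros HA Ht Hq.
destruct (MVT_cor2 (fun r => barrier M A r t) (fun r => barrier_q M A r t) 0 q Hq)
  as [c [He Hc]].
{ intros c _. now apply is_derive_Reals, is_derive_barrier_q. }
exists c; split; [exact Hc|].
rewrite barrier_0 in He. lra.
Qed.

Lemma barrier_pos (M A q t : R) : 0 < M -> 0 < A -> 0 < t -> 0 < q ->
  0 < barrier M A q t.
Proof.
intros HM HA Ht Hq.
destruct (barrier_mvt M A q t) as [c [_ ->]]; try lra.
apply Rmult_lt_0_compat; [now apply barrier_q_pos|exact Hq].
Qed.

Lemma barrier_opp (M A q t : R) : barrier M A (- q) t = - barrier M A q t.
Proof.
unfold barrier.
replace (M / A * - q) with (- (M / A) * q) by ring.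
replace (- (M / A) * - q) with (M / A * q) by ring. ring.
Qed.

Lemma barrier_nonpos (M A q t : R) : 0 < M -> 0 < A -> 0 < t -> q <= 0 ->
  barrier M A q t <= 0.
Proof.
intros HM HA Ht Hq.
destruct (Req_dec q 0) as [->|Hn].
- rewrite barrier_0; lra.
- assert (H := barrier_pos M A (- q) t HM HA Ht ltac:(lra)).
  rewrite barrier_opp in H. lra.
Qed.

(* On [0, M] both exponents are at most [- M^2 / (A t)], and [exp (-y) <= 4 / y^2]. *)
Lemma barrier_q_le (M A q t : R) : 0 < M -> 0 < A -> 0 < t -> 0 <= q <= M ->
  barrier_q M A q t <= 8 * A * t / M ^ 3.
Proof.
intros HM HA Ht Hq.
set (y := M ^ 2 / A / t).
assert (Hy : 0 < y) by (repeat apply Rdiv_lt_0_compat; nra).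
assert (HMA : 0 < / A) by now apply Rinv_0_lt_compat.
assert (Hit : 0 < / t) by now apply Rinv_0_lt_compat.
assert (He : exp (- y) <= 4 / y ^ 2).
{ rewrite exp_Ropp. replace (4 / y ^ 2) with (/ (y ^ 2 / 4)) by (field; lra).
  apply Rinv_le_contravar; [nra|]. apply exp_ge_sqr; lra. }
assert (Hexp : forall r, r <= M -> exp ((M / A * r - 2 * M ^ 2 / A) / t) <= exp (- y)).
{ intros r Hr. apply Rnot_lt_le; intros Hlt; apply exp_lt_inv in Hlt.
  revert Hlt; apply Rle_not_lt. unfold y.
  replace (- (M ^ 2 / A / t)) with (- (M ^ 2) * (/ A * / t)) by (field; lra).
  replace ((M / A * r - 2 * M ^ 2 / A) / t) with ((M * r - 2 * M ^ 2) * (/ A * / t))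
    by (field; lra).
  apply Rmult_le_compat_r; nra. }
unfold barrier_q.
assert (H1 := Hexp q ltac:(lra)).
assert (H2 := Hexp (- q) ltac:(lra)).
replace (M / A * - q) with (- (M / A) * q) in H2 by ring.
replace (8 * A * t / M ^ 3) with (M / A / t * (4 / y ^ 2 + 4 / y ^ 2))
  by (unfold y; field; lra).
apply Rmult_le_compat_l; [|lra].
left; repeat apply Rdiv_lt_0_compat; lra.
Qed.

Lemma barrier_le (M A q t : R) : 0 < M -> 0 < A -> 0 < t -> 0 <= q <= M ->
  barrier M A q t <= 8 * A * t / M ^ 3 * q.
Proof.
intros HM HA Ht Hq.
destruct (Req_dec q 0) as [->|Hn].
- rewrite barrier_0; lra.
- destruct (barrier_mvt M A q t) as [c [Hc ->]]; try lra.
  apply Rmult_le_compat_r; [lra|].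
  apply barrier_q_le; lra.
Qed.

Lemma continuous_barrier (M A q t : R) : t <> 0 ->
  continuous (fun z : R * R => barrier M A (fst z) (snd z)) (q, t).
Proof.
intros Ht. unfold barrier.
assert (Hexp : forall c d : R,
  continuous (fun z : R * R => exp ((c * fst z - d) / snd z)) (q, t)).
{ intros c d.
  apply (continuous_comp (fun z : R * R => (c * fst z - d) / snd z) exp).
  - apply (continuous_mult (K := R_AbsRing) (fun z : R * R => c * fst z - d) (fun z => / snd z)).
    + apply (continuous_minus (V := R_NormedModule) (fun z : R * R => c * fst z) (fun _ => d)).
      * apply (continuous_scal_r (K := R_AbsRing) (V := R_NormedModule) c (fun z : R * R => fst z)).
        apply continuous_fst.
      * apply continuous_const.
    + apply (continuous_comp (fun z : R * R => snd z) Rinv).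
      * apply continuous_snd.
      * now apply continuous_Rinv.
  - apply continuous_exp. }
apply (continuous_minus (V := R_NormedModule)
  (fun z : R * R => exp ((M / A * fst z - 2 * M ^ 2 / A) / snd z))
  (fun z : R * R => exp ((- (M / A) * fst z - 2 * M ^ 2 / A) / snd z))); apply Hexp.
Qed.

(** * Integer multiples of a period and real-valued derivative rules *)

Lemma periodic_Z (f : R -> R) (L : R) : (forall x, f (x + L) = f x) ->
  forall (n : Z) (x : R), f (x + IZR n * L) = f x.
Proof.
intros Hf.
assert (Hn : forall (n : nat) (x : R), f (x + INR n * L) = f x).
{ induction n as [|n IH]; intros x.
  - simpl. f_equal; ring.
  - rewrite S_INR, <- (IH x), <- (Hf (x + INR n * L)). f_equal; ring. }
intros [|p|p] x.
- f_equal; ring.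
- specialize (Hn (Pos.to_nat p) x). now rewrite INR_IPR in Hn.
- rewrite <- (Hn (Pos.to_nat p) (x + _)), INR_IPR.
  f_equal. change (IZR (Z.neg p)) with (- IPR p). ring.
Qed.

Lemma is_derive_minus_R (f g : R -> R) (x df dg l : R) :
  is_derive f x df -> is_derive g x dg -> l = df - dg ->
  is_derive (fun y => f y - g y) x l.
Proof. intros Hf Hg ->. now apply (is_derive_minus (V := R_NormedModule) f g). Qed.

Lemma is_derive_comp_R (f g : R -> R) (x df dg l : R) :
  is_derive f (g x) df -> is_derive g x dg -> l = df * dg ->
  is_derive (fun y => f (g y)) x l.
Proof.
intros Hf Hg ->. rewrite Rmult_comm. now apply (is_derive_comp f g).
Qed.

(** * The two-point comparison with the barrier *)

(** The function and its derivatives are abstract so that both [u] and [- u] fit. The equation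
    enters only through pairs of points with equal steep slopes, where the [b] terms cancel. The
    Lipschitz constant [K] only fixes a starting time inside the proof and does not affect the
    conclusion. *)
Lemma two_point_estimate (M A P L K T : R) (w wx wxx wt : R -> R -> R) :
  0 < M -> 0 < A -> 0 < P -> 0 < L -> 0 <= K ->
  (forall x t, 0 < t < T -> continuous (fun z : R * R => w (fst z) (snd z)) (x, t)) ->
  (forall x t, 0 < t < T -> is_derive (fun y => w y t) x (wx x t)) ->
  (forall x t, 0 < t < T -> is_derive (fun y => wx y t) x (wxx x t)) ->
  (forall x t, 0 < t < T -> is_derive (fun s => w x s) t (wt x t)) ->
  (forall x y t, 0 < t < T -> y <= x -> w x t - w y t <= K * (x - y)) ->
  (forall x t, 0 < t < T -> w (x + L) t = w x t) ->
  (forall x y t, 0 < t < T -> w x t - w y t <= M) ->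
  (forall x y t, 0 < t < T -> wx x t = wx y t -> P <= Rabs (wx x t) ->
     exists c d, A <= c * wx x t ^ 2 /\ A <= d * wx x t ^ 2 /\
       wt x t - wt y t = c * wxx x t - d * wxx y t) ->
  forall x y t, y <= x -> 0 < t < T -> t <= M ^ 3 / (8 * A * P) ->
  barrier M A (w x t - w y t) t <= x - y.
Proof.
intros HM HA HP HL HK Hcont Hwx Hwxx Hwt HLip Hper Hosc Heq x1 y1 t1 Hyx Ht1 HtP.
apply Rnot_lt_le; intros Hneg.
(* The coordinates are [(y, s, t)] with [s = x - y]: the constraint [y <= x] becomes [s >= 0], and
   [F] is periodic in [y]. *)
set (F := fun z : R * R * R =>
  snd (fst z) - barrier M A (w (fst (fst z) + snd (fst z)) (snd z) - w (fst (fst z)) (snd z)) (snd z)).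
assert (HM3 : 0 < M ^ 3) by now apply pow_lt.
(* The time threshold is chosen for this: it forces [barrier_q <= / P] on [[0, M]], so a critical
   slope [/ barrier_q] is at least [P]. *)
assert (Hslope : forall t, t <= M ^ 3 / (8 * A * P) -> 8 * A * t / M ^ 3 <= / P).
{ intros t Ht. replace (/ P) with (8 * A * (M ^ 3 / (8 * A * P)) / M ^ 3) by (field; lra).
  apply Rmult_le_compat_r; [now left; apply Rinv_0_lt_compat|].
  apply Rmult_le_compat_l; lra. }
assert (Hpos : forall y s t, 0 < t < T -> 0 <= s ->
  (0 < w (y + s) t - w y t -> 8 * A * t / M ^ 3 * (w (y + s) t - w y t) <= s) ->
  0 <= F (y, s, t)).
{ intros y s t Ht Hs Hq. unfold F; simpl.
  destruct (Rle_lt_dec (w (y + s) t - w y t) 0) as [H0|H0].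
  - assert (H := barrier_nonpos M A _ t HM HA (proj1 Ht) H0). lra.
  - assert (H := barrier_le M A (w (y + s) t - w y t) t HM HA (proj1 Ht)
      (conj (Rlt_le _ _ H0) (Hosc _ _ _ Ht))).
    specialize (Hq H0). lra. }
assert (HMP : 0 < M / P) by now apply Rdiv_lt_0_compat.
(* The barrier is at most [M / P] on [[0, M]], so only separations below [M / P] matter; this makes
   the search region compact in [s]. *)
assert (Hlarge : forall y s t, 0 < t <= t1 -> M / P <= s -> 0 <= F (y, s, t)).
{ intros y s t Ht Hs. apply Hpos; [lra|lra|intros Hq].
  assert (H1 := Hslope t ltac:(lra)).
  assert (H2 := Hosc (y + s) y t ltac:(lra)).
  apply Rle_trans with (/ P * M).
  - apply Rle_trans with (/ P * (w (y + s) t - w y t)).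
    + apply Rmult_le_compat_r; lra.
    + apply Rmult_le_compat_l; [left; now apply Rinv_0_lt_compat|lra].
  - unfold Rdiv in Hs; lra. }
(* At this time the barrier has slope at most [/ (K + 1)] on [[0, M]], which beats the Lipschitz
   constant [K]. The added 1 also covers [K = 0]. *)
set (delta := Rmin t1 (M ^ 3 / (8 * A * (K + 1)))).
assert (Hdelta : 0 < delta <= t1 /\ delta <= M ^ 3 / (8 * A * (K + 1))).
{ unfold delta; split; [split|]; [|apply Rmin_l|apply Rmin_r].
  apply Rmin_pos; [lra|]. apply Rdiv_lt_0_compat; nra. }
assert (Hsmall : forall y s, 0 <= s -> 0 <= F (y, s, delta)).
{ intros y s Hs. apply Hpos; [lra|lra|intros Hq].
  assert (H1 := HLip (y + s) y delta ltac:(lra) ltac:(lra)).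
  replace (y + s - y) with s in H1 by ring.
  assert (H2 : 8 * A * delta / M ^ 3 <= / (K + 1)).
  { replace (/ (K + 1)) with (8 * A * (M ^ 3 / (8 * A * (K + 1))) / M ^ 3) by (field; lra).
    apply Rmult_le_compat_r; [now left; apply Rinv_0_lt_compat|].
    apply Rmult_le_compat_l; lra. }
  apply Rle_trans with (/ (K + 1) * ((K + 1) * s)).
  - apply Rmult_le_compat; try lra.
    apply Rdiv_le_0_compat; [nra|lra].
  - right; field; lra. }
set (D := M / P + 1).
assert (HFcont : forall z, box 0 L 0 D delta t1 z -> continuous F z).
{ intros [[y s] t] [_ [_ Ht]]. simpl in Ht.
  apply (continuous_minus (V := R_NormedModule) (fun z : R * R * R => snd (fst z))).
  - apply (continuous_comp (fun z : R * R * R => fst z) snd);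
      [apply continuous_fst|apply continuous_snd].
  - assert (C1 : continuous (fun z : R * R * R => fst (fst z)) (y, s, t)).
    { apply (continuous_comp (fun z : R * R * R => fst z) fst); apply continuous_fst. }
    assert (C2 : continuous (fun z : R * R * R => snd (fst z)) (y, s, t)).
    { apply (continuous_comp (fun z : R * R * R => fst z) snd);
        [apply continuous_fst|apply continuous_snd]. }
    assert (C3 : continuous (fun z : R * R * R => snd z) (y, s, t)) by apply continuous_snd.
    apply (continuous_comp_2
      (fun z : R * R * R => w (fst (fst z) + snd (fst z)) (snd z) - w (fst (fst z)) (snd z))
      (fun z : R * R * R => snd z) (fun q r => barrier M A q r)); [|exact C3|].
    + apply (continuous_minus (V := R_NormedModule)
        (fun z : R * R * R => w (fst (fst z) + snd (fst z)) (snd z))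
        (fun z : R * R * R => w (fst (fst z)) (snd z))).
      * apply (continuous_comp_2 (fun z : R * R * R => fst (fst z) + snd (fst z))
          (fun z : R * R * R => snd z) w); [|exact C3|simpl; apply Hcont; lra].
        now apply (continuous_plus (V := R_NormedModule)
          (fun z : R * R * R => fst (fst z)) (fun z : R * R * R => snd (fst z))).
      * apply (continuous_comp_2 (fun z : R * R * R => fst (fst z))
          (fun z : R * R * R => snd z) w); [exact C1|exact C3|simpl; apply Hcont; lra].
    + apply continuous_barrier; simpl; lra. }
destruct (box_argmin F 0 L 0 D delta t1) as [[[y0 s0] t0] [[_ [Hs0 Ht0]] Hmin]];
  [lra|unfold D; lra|lra|exact HFcont|].
simpl in Hs0, Ht0.
(* Periodicity removes the restriction on [y], so the minimum can be treated as interior in that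
   variable. *)
assert (Hglob : forall y s t, 0 <= s <= D -> delta <= t <= t1 ->
  F (y0, s0, t0) <= F (y, s, t)).
{ intros y s t Hs Ht.
  set (n := Int_part (y / L)).
  destruct (base_Int_part (y / L)) as [Hn1 Hn2]; fold n in Hn1, Hn2.
  assert (Hy : y = y / L * L) by (field; lra).
  apply Rle_trans with (F (y + IZR (- n) * L, s, t)).
  - apply Hmin. unfold box; simpl. rewrite opp_IZR. repeat split; nra.
  - right. unfold F; simpl.
    rewrite (periodic_Z (fun x => w x t) L) by (intros; apply Hper; lra).
    replace (y + IZR (- n) * L + s) with (y + s + IZR (- n) * L) by ring.
    now rewrite (periodic_Z (fun x => w x t) L) by (intros; apply Hper; lra). }
assert (HFneg : F (y0, s0, t0) < 0).
{ destruct (Rle_lt_dec (M / P) (x1 - y1)) as [Hl|Hl].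
  - assert (H := Hlarge y1 (x1 - y1) t1 ltac:(lra) Hl).
    unfold F in H; simpl in H. replace (y1 + (x1 - y1)) with x1 in H by ring. lra.
  - apply Rle_lt_trans with (F (y1, x1 - y1, t1)).
    + apply Hglob; unfold D; lra.
    + unfold F; simpl. replace (y1 + (x1 - y1)) with x1 by ring. lra. }
assert (HsD : s0 < M / P).
{ apply Rnot_le_lt; intros H. assert (H' := Hlarge y0 s0 t0 ltac:(lra) H). lra. }
assert (Htd : delta < t0).
{ destruct (Req_dec t0 delta) as [E|]; [|lra].
  assert (H := Hsmall y0 s0 ltac:(lra)). rewrite <- E in H. lra. }
assert (HsP : 0 < s0).
{ destruct (Req_dec s0 0) as [E|]; [|lra].
  exfalso. unfold F in HFneg; simpl in HFneg. rewrite E, Rplus_0_r, Rminus_diag, barrier_0 in HFneg.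
  lra. }
set (x0 := y0 + s0) in *.
set (q0 := w x0 t0 - w y0 t0).
assert (Hq0 : 0 < q0 <= M).
{ split; [|apply Hosc; lra].
  apply Rnot_le_lt; intros H.
  assert (H' := barrier_nonpos M A q0 t0 HM HA ltac:(lra) H).
  unfold F in HFneg; simpl in HFneg. fold x0 q0 in HFneg. lra. }
assert (Hbq : 0 < barrier_q M A q0 t0) by (apply barrier_q_pos; lra).
assert (Hbqq : 0 < barrier M A q0 t0) by (apply barrier_pos; lra).
(* Moving either endpoint by less than [rho] keeps the separation between 0 and [M / P]. *)
set (rho := Rmin s0 (M / P - s0)).
assert (Hrho : 0 < rho /\ rho <= s0 /\ rho <= M / P - s0).
{ unfold rho; split; [apply Rmin_pos; lra|split; [apply Rmin_l|apply Rmin_r]]. }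
assert (Hbase : F (y0, s0, t0) = x0 - y0 - barrier M A q0 t0).
{ unfold F, q0, x0; simpl; ring. }
assert (Dx : forall x, is_derive
  (fun x => x - y0 - barrier M A (w x t0 - w y0 t0) t0) x
  (1 - barrier_q M A (w x t0 - w y0 t0) t0 * wx x t0)).
{ intros x.
  apply is_derive_minus_R with 1 (barrier_q M A (w x t0 - w y0 t0) t0 * wx x t0).
  - auto_derive; [easy|ring].
  - apply (is_derive_comp_R (fun q => barrier M A q t0) (fun x => w x t0 - w y0 t0) x
      (barrier_q M A (w x t0 - w y0 t0) t0) (wx x t0));
      [apply is_derive_barrier_q; lra| |ring].
    apply is_derive_minus_R with (wx x t0) 0; [apply Hwx; lra|apply @is_derive_const|ring].
  - ring. }
assert (Dxx : is_derive
  (fun x => 1 - barrier_q M A (w x t0 - w y0 t0) t0 * wx x t0) x0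
  (- (barrier_qq M A q0 t0 * wx x0 t0 ^ 2 + barrier_q M A q0 t0 * wxx x0 t0))).
{ apply is_derive_minus_R with 0
    (barrier_qq M A q0 t0 * wx x0 t0 * wx x0 t0 + barrier_q M A q0 t0 * wxx x0 t0);
    [apply @is_derive_const| |ring].
  apply (is_derive_mult (fun x => barrier_q M A (w x t0 - w y0 t0) t0) (fun x => wx x t0));
    [|apply Hwxx; lra|exact Rmult_comm].
  apply (is_derive_comp_R (fun q => barrier_q M A q t0) (fun x => w x t0 - w y0 t0) x0
    (barrier_qq M A q0 t0) (wx x0 t0)); [apply is_derive_barrier_qq; lra| |ring].
  apply is_derive_minus_R with (wx x0 t0) 0; [apply Hwx; lra|apply @is_derive_const|ring]. }
assert (Mx : forall x, Rabs (x - x0) < rho ->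
  x0 - y0 - barrier M A (w x0 t0 - w y0 t0) t0 <= x - y0 - barrier M A (w x t0 - w y0 t0) t0).
{ intros x Hx. apply Rabs_lt_between in Hx. fold q0; rewrite <- Hbase.
  assert (H := Hglob y0 (x - y0) t0 ltac:(unfold D, x0 in *; lra) ltac:(lra)).
  unfold F in H at 2; simpl in H.
  now replace (y0 + (x - y0)) with x in H by ring. }
assert (Hpx : 1 - barrier_q M A q0 t0 * wx x0 t0 = 0)
  by exact (is_derive_local_min _ _ x0 rho (proj1 Hrho) (Dx x0) Mx).
assert (Hxx := second_derivative_local_min _ _ _ x0 rho (proj1 Hrho) (fun x _ => Dx x) Dxx Mx).
assert (Dy : forall y, is_derive
  (fun y => x0 - y - barrier M A (w x0 t0 - w y t0) t0) y
  (barrier_q M A (w x0 t0 - w y t0) t0 * wx y t0 - 1)).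
{ intros y.
  apply is_derive_minus_R with (-1) (- barrier_q M A (w x0 t0 - w y t0) t0 * wx y t0).
  - auto_derive; [easy|ring].
  - apply (is_derive_comp_R (fun q => barrier M A q t0) (fun y => w x0 t0 - w y t0) y
      (barrier_q M A (w x0 t0 - w y t0) t0) (- wx y t0));
      [apply is_derive_barrier_q; lra| |ring].
    apply is_derive_minus_R with 0 (wx y t0); [apply @is_derive_const|apply Hwx; lra|ring].
  - ring. }
assert (Dyy : is_derive
  (fun y => barrier_q M A (w x0 t0 - w y t0) t0 * wx y t0 - 1) y0
  (- (barrier_qq M A q0 t0 * wx y0 t0 ^ 2) + barrier_q M A q0 t0 * wxx y0 t0)).
{ apply is_derive_minus_R with
    (- (barrier_qq M A q0 t0 * wx y0 t0) * wx y0 t0 + barrier_q M A q0 t0 * wxx y0 t0) 0;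
    [|apply @is_derive_const|ring].
  apply (is_derive_mult (fun y => barrier_q M A (w x0 t0 - w y t0) t0) (fun y => wx y t0));
    [|apply Hwxx; lra|exact Rmult_comm].
  apply (is_derive_comp_R (fun q => barrier_q M A q t0) (fun y => w x0 t0 - w y t0) y0
    (barrier_qq M A q0 t0) (- wx y0 t0)); [apply is_derive_barrier_qq; lra| |ring].
  apply is_derive_minus_R with 0 (wx y0 t0); [apply @is_derive_const|apply Hwx; lra|ring]. }
assert (My : forall y, Rabs (y - y0) < rho ->
  x0 - y0 - barrier M A (w x0 t0 - w y0 t0) t0 <= x0 - y - barrier M A (w x0 t0 - w y t0) t0).
{ intros y Hy. apply Rabs_lt_between in Hy. fold q0; rewrite <- Hbase.
  assert (H := Hglob y (x0 - y) t0 ltac:(unfold D, x0 in *; lra) ltac:(lra)).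
  unfold F in H at 2; simpl in H.
  now replace (y + (x0 - y)) with x0 in H by ring. }
assert (Hpy : barrier_q M A q0 t0 * wx y0 t0 - 1 = 0)
  by exact (is_derive_local_min _ _ y0 rho (proj1 Hrho) (Dy y0) My).
assert (Hyy := second_derivative_local_min _ _ _ y0 rho (proj1 Hrho) (fun y _ => Dy y) Dyy My).
assert (Dt : is_derive (fun t => x0 - y0 - barrier M A (w x0 t - w y0 t) t) t0
  (- (barrier_t M A q0 t0 + barrier_q M A q0 t0 * (wt x0 t0 - wt y0 t0)))).
{ apply is_derive_minus_R with 0
    (barrier_t M A q0 t0 + barrier_q M A q0 t0 * (wt x0 t0 - wt y0 t0));
    [apply @is_derive_const| |ring].
  apply (is_derive_barrier_comp M A t0 _ (fun t => w x0 t - w y0 t)); [lra|lra|].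
  now apply is_derive_minus_R with (wt x0 t0) (wt y0 t0); [apply Hwt; lra|apply Hwt; lra|]. }
(* Since [t0] may equal [t1], only earlier times, back to [delta], are compared. *)
assert (Htime : - (barrier_t M A q0 t0 + barrier_q M A q0 t0 * (wt x0 t0 - wt y0 t0)) <= 0).
{ apply (is_derive_left_min _ _ t0 (t0 - delta) ltac:(lra) Dt).
  intros s Hs. fold q0; rewrite <- Hbase.
  assert (H := Hglob y0 s0 s ltac:(lra) ltac:(lra)).
  unfold F in H at 2; simpl in H. fold x0 in H.
  now replace (x0 - y0) with s0 by (unfold x0; ring). }
assert (Hpp : wx x0 t0 = wx y0 t0) by (apply (Rmult_eq_reg_l (barrier_q M A q0 t0)); lra).
assert (HPp : P <= wx x0 t0).
{ replace (wx x0 t0) with (/ barrier_q M A q0 t0).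
  - rewrite <- (Rinv_inv P). apply Rinv_le_contravar; [exact Hbq|].
    apply Rle_trans with (8 * A * t0 / M ^ 3);
      [apply barrier_q_le; lra|apply Hslope; lra].
  - apply (Rmult_eq_reg_l (barrier_q M A q0 t0)); [rewrite Rinv_r|]; lra. }
destruct (Heq x0 y0 t0 ltac:(lra) Hpp) as [c [d [Hc [Hd Hcd]]]].
{ rewrite Rabs_pos_eq; lra. }
rewrite Hcd in Htime. rewrite <- Hpp in Hyy. unfold barrier_t in Htime.
assert (Hqq : 0 < barrier_qq M A q0 t0).
{ apply Rmult_lt_0_compat; [|exact Hbqq].
  apply pow_lt. repeat apply Rdiv_lt_0_compat; lra. }
assert (Hgap : 0 < q0 / t0 * barrier_q M A q0 t0).
{ apply Rmult_lt_0_compat; [apply Rdiv_lt_0_compat; lra|exact Hbq]. }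
(* What remains is algebra. The second-order conditions bound [barrier_q * (wt x0 t0 - wt y0 t0)]
   above by [- 2 * A * bqq], while [Htime] bounds it below by [gap - 2 * A * bqq] with [gap > 0]. *)
revert Hxx Hyy Htime Hgap Hqq Hc Hd.
generalize (barrier_qq M A q0 t0) (q0 / t0 * barrier_q M A q0 t0).
intros bqq gap Hxx Hyy Htime Hgap Hqq Hc Hd.
assert (Hp2 : 0 < wx x0 t0 ^ 2) by (apply pow_lt; lra).
assert (Hc0 : 0 < c) by nra.
assert (Hd0 : 0 < d) by nra.
assert (E1 : c * (barrier_q M A q0 t0 * wxx x0 t0) <= - (A * bqq)).
{ apply Rle_trans with (c * - (bqq * wx x0 t0 ^ 2));
    [apply Rmult_le_compat_l; lra|].
  assert (A * bqq <= c * wx x0 t0 ^ 2 * bqq) by (apply Rmult_le_compat_r; lra). lra. }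
assert (E2 : A * bqq <= d * (barrier_q M A q0 t0 * wxx y0 t0)).
{ apply Rle_trans with (d * (bqq * wx x0 t0 ^ 2));
    [|apply Rmult_le_compat_l; lra].
  assert (A * bqq <= d * wx x0 t0 ^ 2 * bqq) by (apply Rmult_le_compat_r; lra). lra. }
lra.
Qed.

(** * From the comparison and the hypotheses to pointwise bounds *)

(** Both sides of the barrier bound vanish at [y = x], so their derivatives there compare:
    [barrier_q M A 0 t * l <= 1]. The right-hand side is the reciprocal of [barrier_q M A 0 t].
    Writing [y = x - s] turns the one-sided bound into a minimum from the left at [s = 0]. *)
Lemma slope_le_of_barrier (M A t x l : R) (f : R -> R) :
  0 < M -> 0 < A -> 0 < t -> is_derive f x l ->
  (forall y, x <= y -> barrier M A (f y - f x) t <= y - x) ->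
  l <= A / (2 * M) * t * exp (2 * M ^ 2 / A / t).
Proof.
intros HM HA Ht Hf Hb.
assert (Hd : is_derive (fun s => - s - barrier M A (f (x - s) - f x) t) 0
  (-1 + barrier_q M A 0 t * l)).
{ apply is_derive_minus_R with (-1) (- barrier_q M A 0 t * l).
  - auto_derive; [easy|ring].
  - apply (is_derive_comp_R (fun q => barrier M A q t) (fun s => f (x - s) - f x) 0
      (barrier_q M A 0 t) (- l)); [| |ring].
    + rewrite Rminus_0_r, Rminus_diag. apply is_derive_barrier_q; lra.
    + apply is_derive_minus_R with (- l) 0; [|apply @is_derive_const|ring].
      apply (is_derive_comp_R f (fun s => x - s) 0 l (-1)); [now rewrite Rminus_0_r| |ring].
      auto_derive; [easy|ring].
  - ring. }
assert (H : -1 + barrier_q M A 0 t * l <= 0).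
{ apply (is_derive_left_min _ _ 0 1 Rlt_0_1 Hd).
  intros s Hs. rewrite Rminus_0_r, Rminus_diag, barrier_0.
  assert (H := Hb (x - s) ltac:(lra)). lra. }
assert (Hq : barrier_q M A 0 t * (A / (2 * M) * t * exp (2 * M ^ 2 / A / t)) = 1).
{ unfold barrier_q. rewrite !Rmult_0_r.
  replace ((0 - 2 * M ^ 2 / A) / t) with (- (2 * M ^ 2 / A / t)) by (field; lra).
  rewrite exp_Ropp. assert (He := exp_pos (2 * M ^ 2 / A / t)).
  field; lra. }
apply (Rmult_le_reg_l (barrier_q M A 0 t)); [now apply barrier_q_pos|lra].
Qed.

(** The values of [f] are real, so the supremum is not [m_infty] and the infimum is not [p_infty].
    Hence the subtraction never meets an indeterminate form with its default value. *)
Lemma osc_bound (f : R -> R) (M x y : R) : Rbar_le (osc f) M -> f x - f y <= M.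
Proof.
unfold osc.
destruct (Lub_Rbar_correct (fun r => exists x, r = f x)) as [H1 _].
destruct (Glb_Rbar_correct (fun r => exists x, r = f x)) as [H2 _].
specialize (H1 (f x) (ex_intro _ x eq_refl)).
specialize (H2 (f y) (ex_intro _ y eq_refl)).
destruct (Lub_Rbar _), (Glb_Rbar _); simpl in *; try easy.
lra.
Qed.

(** [Rbar_plus] sends [p_infty] plus [m_infty] to 0, so a finite norm does not at once give finite
    terms. On nonempty [Q] the sup norms are nonnegative, and the seminorm is [m_infty] only if [Q]
    has no two distinct points; then the gradient is bounded anyway. *)
Lemma H2_gradient_bound (Q : R -> R -> Prop) (u : R -> R -> R) :
  in_H2 Q u -> exists K, 0 <= K /\ forall x t, Q x t -> Rabs (d_x u x t) <= K.
Proof.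
intros [_ Hfin].
destruct (classic (exists x t, Q x t)) as [[x0 [t0 Q0]]|Hempty].
2: { exists 0; split; [lra|]. intros x t Qxt; exfalso; eauto. }
assert (Hsup : forall w, Rbar_le 0 (sup_norm Q w)).
{ intros w. apply Rbar_le_trans with (Rabs (w x0 t0)); [apply Rabs_pos|].
  apply (proj1 (Lub_Rbar_correct _)); eauto. }
assert (Hhol : sup_norm Q (d_x u) = p_infty -> holder_seminorm 1 Q (d_x u) <> m_infty).
{ intros Hinf Hm.
  destruct (classic (exists x t, Q x t /\ (x, t) <> (x0, t0))) as [[x [t [Qxt Hne]]]|Hone].
  - assert (H := proj1 (Lub_Rbar_correct (fun r => exists x1 t1 x2 t2,
      Q x1 t1 /\ Q x2 t2 /\ (x1, t1) <> (x2, t2) /\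
      r = Rabs (d_x u x1 t1 - d_x u x2 t2)
        / Rpower (Rabs (x1 - x2) + sqrt (Rabs (t1 - t2))) 1)) _
      (ex_intro _ x (ex_intro _ t (ex_intro _ x0 (ex_intro _ t0
        (conj Qxt (conj Q0 (conj Hne eq_refl)))))))).
    unfold holder_seminorm in Hm. rewrite Hm in H. exact H.
  - assert (H : Rbar_le (sup_norm Q (d_x u)) (Rabs (d_x u x0 t0))).
    { apply (proj2 (Lub_Rbar_correct _)). intros r [x [t [Qxt ->]]].
      destruct (classic ((x, t) = (x0, t0))) as [E|Hne].
      - injection E as -> ->. simpl; lra.
      - exfalso; eauto. }
    rewrite Hinf in H. exact H. }
assert (Hd := Hsup (d_x u)). specialize (Hsup u).
unfold H2_norm in Hfin.
destruct (sup_norm Q (d_x u)) as [K| |] eqn:EK; [|exfalso|easy].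
- exists K; split; [exact Hd|].
  intros x t Qxt.
  assert (H := proj1 (Lub_Rbar_correct (fun r => exists x t, Q x t /\ r = Rabs (d_x u x t)))
    _ (ex_intro _ x (ex_intro _ t (conj Qxt eq_refl)))).
  unfold sup_norm in EK. rewrite EK in H. exact H.
- specialize (Hhol eq_refl).
  destruct (sup_norm Q u), (holder_seminorm 1 Q (d_x u)); simpl in *; try easy; now inversion Hfin.
Qed.

Theorem theorem3p2 :
  forall M A P : R, 0 < M -> 0 < A -> 0 < P ->
  exists T' C1 C2 : R, 0 < T' /\
  forall L T : R, 0 < L -> 0 < T ->
  forall (a : R -> R -> R -> R -> R) (b u0 : R -> R) (u : R -> R -> R),
  (forall p q x t, 0 <= t < T -> 0 < a p q x t) ->
  (forall x, continuous u0 x) ->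
  (forall x, u0 (x + L) = u0 x) ->
  (forall p q x t, 0 <= t < T -> a p q x t = a p q (x + L) t) ->
  in_H2 (slab T) u ->
  classical_solution a b T u0 u ->
  (forall x t, 0 <= t < T -> u (x + L) t = u x t) ->
  (forall t, 0 <= t < T -> Rbar_le (osc (fun x => u x t)) M) ->
  (forall p q x t, 0 <= t < T -> P <= Rabs p -> A <= a p q x t * p ^ 2) ->
  forall x t, 0 < t <= T' -> t < T ->
  Rabs (d_x u x t) <= C1 * sqrt t * (1 + t) * exp (C2 / t).
Proof.
intros M A P HM HA HP.
(* With [k = M / A], the last two constants are [1 / (2 k)] and [C = 2 A k^2], read off from
   [/ barrier_q M A 0 t]. *)
exists (M ^ 3 / (8 * A * P)), (A / (2 * M)), (2 * M ^ 2 / A).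
split; [apply Rdiv_lt_0_compat; [now apply pow_lt|nra]|].
intros L T HL HT a b u0 u _ _ _ _ HH2 Hsol Hper Hosc Hell x t Ht HtT.
destruct (H2_gradient_bound _ _ HH2) as [K [HK HuK]].
assert (Hux : forall y s, 0 < s < T -> is_derive (fun z => u z s) y (d_x u y s)).
{ intros y s Hs. apply Derive_correct, (cs_ex_d_x _ _ _ _ _ Hsol); lra. }
assert (Huxx : forall y s, 0 < s < T -> is_derive (fun z => d_x u z s) y (d_xx u y s)).
{ intros y s Hs. apply Derive_correct, (cs_ex_d_xx _ _ _ _ _ Hsol y s Hs). }
assert (Hut : forall y s, 0 < s < T -> is_derive (fun r => u y r) s (d_t u y s)).
{ intros y s Hs. apply Derive_correct, (cs_ex_d_t _ _ _ _ _ Hsol); lra. }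
(* At positive times below [T] the slab contains a neighbourhood of the point, so relative
   continuity becomes ordinary continuity. *)
assert (Hcont : forall y s, 0 < s < T ->
  continuous (fun z : R * R => u (fst z) (snd z)) (y, s)).
{ intros y s Hs. apply filterlim_locally. intros eps.
  assert (Hc := proj1 (filterlim_locally _ _)
    (cs_continuous _ _ _ _ _ Hsol y s (conj (Rlt_le _ _ (proj1 Hs)) (proj2 Hs))) eps).
  assert (Hpos : 0 < Rmin s (T - s)) by (apply Rmin_pos; lra).
  unfold within in Hc.
  generalize (filter_and _ _ Hc (locally_ball (y, s) (mkposreal _ Hpos))).
  apply filter_imp. intros [y' s'] [Hz [_ Hb]].
  apply Hz. apply Rabs_lt_between in Hb.
  unfold minus, plus, opp in Hb; simpl in Hb.
  assert (Hl := Rmin_l s (T - s)); assert (Hr := Rmin_r s (T - s)).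
  unfold slab; simpl; lra. }
assert (HLip : forall y z s, 0 < s < T -> z <= y -> Rabs (u y s - u z s) <= K * (y - z)).
{ intros y z s Hs Hzy.
  destruct (Req_dec y z) as [->|Hn].
  - rewrite !Rminus_diag, Rabs_R0; lra.
  - destruct (MVT_cor2 (fun r => u r s) (fun r => d_x u r s) z y ltac:(lra)) as [c [-> Hc]].
    { intros c _; now apply is_derive_Reals, Hux. }
    rewrite Rabs_mult, (Rabs_pos_eq (y - z)) by lra.
    apply Rmult_le_compat_r; [lra|apply HuK; unfold slab; lra]. }
assert (Hup := two_point_estimate M A P L K T u (d_x u) (d_xx u) (d_t u) HM HA HP HL HK
  Hcont Hux Huxx Hut).
assert (Hdown := two_point_estimate M A P L K T (fun y s => - u y s)
  (fun y s => - d_x u y s) (fun y s => - d_xx u y s) (fun y s => - d_t u y s) HM HA HP HL HK).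
assert (Hupper : d_x u x t <= A / (2 * M) * t * exp (2 * M ^ 2 / A / t)).
{ apply (slope_le_of_barrier M A t x _ (fun y => u y t) HM HA (proj1 Ht));
    [apply Hux; lra|].
  intros y Hy. apply Hup; [| | | |exact Hy|lra|lra].
  - intros y' z s Hs Hz. eapply Rle_trans; [apply Rle_abs|now apply HLip].
  - intros y' s Hs; apply Hper; lra.
  - intros y' z s Hs. apply (osc_bound (fun x => u x s)), Hosc; lra.
  - intros y' z s Hs Hp HPp.
    (* The diffusion coefficients may differ at the two points. Equal gradients cancel [b] and put
       both points in the range of the lower bound on [a p^2]. *)
    exists (a (d_x u y' s) (u y' s) y' s), (a (d_x u z s) (u z s) z s).
    rewrite !(cs_equation _ _ _ _ _ Hsol) by lra.
    split; [apply Hell; [lra|exact HPp]|split].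
    + rewrite Hp; apply Hell; [lra|now rewrite <- Hp].
    + rewrite Hp; ring. }
assert (Hlower : - d_x u x t <= A / (2 * M) * t * exp (2 * M ^ 2 / A / t)).
{ apply (slope_le_of_barrier M A t x _ (fun y => - u y t) HM HA (proj1 Ht));
    [apply @is_derive_opp, Hux; lra|].
  intros y Hy. apply Hdown; [| | | | | | | |exact Hy|lra|lra].
  - intros y' s Hs.
    now apply (continuous_opp (V := R_NormedModule) (fun z : R * R => u (fst z) (snd z))), Hcont.
  - intros y' s Hs. apply @is_derive_opp. now apply Hux.
  - intros y' s Hs. apply (is_derive_opp (V := R_NormedModule) (fun r => d_x u r s)). now apply Huxx.
  - intros y' s Hs. apply @is_derive_opp. now apply Hut.
  - intros y' z s Hs Hz. assert (H := HLip y' z s Hs Hz).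
    apply Rabs_le_between in H. lra.
  - intros y' s Hs; f_equal; apply Hper; lra.
  - intros y' z s Hs.
    assert (H := osc_bound (fun x => u x s) M z y' (Hosc s ltac:(lra))); simpl in H; lra.
  - intros y' z s Hs Hp HPp. apply Ropp_eq_reg in Hp. rewrite Rabs_Ropp in HPp.
    exists (a (d_x u y' s) (u y' s) y' s), (a (d_x u z s) (u z s) z s).
    replace ((- d_x u y' s) ^ 2) with (d_x u y' s ^ 2) by ring.
    rewrite !(cs_equation _ _ _ _ _ Hsol) by lra.
    split; [apply Hell; [lra|exact HPp]|split].
    + rewrite Hp; apply Hell; [lra|now rewrite <- Hp].
    + rewrite Hp; ring. }
apply Rle_trans with (A / (2 * M) * t * exp (2 * M ^ 2 / A / t)).
- apply Rabs_le; lra.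
- apply Rmult_le_compat_r; [left; apply exp_pos|].
  rewrite Rmult_assoc. apply Rmult_le_compat_l; [left; apply Rdiv_lt_0_compat; lra|].
  (* With [r = sqrt t], the claim [t <= sqrt t * (1 + t)] follows from [r <= 1 + r^2]. *)
  assert (Hs := sqrt_sqrt t ltac:(lra)). assert (H0 := sqrt_pos t). nra.
Qed.
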